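(* Let $n\ge 2$ and let $\mathbf{g}=\{g_1,\dots,g_r\}$ and $\mathbf{h}=\{h_1,\dots,h_s\}$ be finite sets of polynomials in $\mathbb{R}[\mathbf{x}]=\mathbb{R}[x_1,\dots,x_n]$. Suppose that $\mathbf{A}=\mathcal{S}(\mathbf{g})=\{x\in\mathbb{R}^n : g_i(x)\ge 0,\ i=1,\dots,r\}$ and $\mathbf{B}=\mathcal{S}(\mathbf{h})=\{x\in\mathbb{R}^n : h_i(x)\ge 0,\ i=1,\dots,s\}$ are nonempty, compact, disjoint and contained in $[-1,1]^n$. Assume that both families are normalized: $1-\|x\|_2^2\in\mathcal{Q}(\mathbf{g})$ and $1-\|x\|_2^2\in\mathcal{Q}(\mathbf{h})$, and $\|g_i\|\le\frac12$ for $i=1,\dots,r$ and $\|h_i\|\le \frac12$ for $i=1,\dots,s$. Let $\mathfrak{c}$ and $T$ be a Lojasiewicz coefficient and exponent for $\mathbf{g}$ and for $\mathbf{h}$, let $\gamma(n,\mathbf{g})$ and $\gamma(n,\mathbf{h})$ be the associated constants, and let $C$ be the absolute constant of the multivariate Jackson inequality (all defined in the context). Then for every integer $l$ with $$l \;\geq\; \max\{\gamma(n,\mathbf{g}),\gamma(n,\mathbf{h})\}\; C^{3.5nT}\, n^{3nT}\left(\frac{6}{\mathrm{dist}(\mathbf{A},\mathbf{B})}\right)^{6nT}$$ there exists a separating polynomial of degree $l$ for $\mathbf{A}$ and $\mathbf{B}$, i.e. a polynomial $p\in\mathbb{R}[\mathbf{x}]$ of degree $l$ such that $p(x)\ge 1$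 for all $x\in\mathbf{A}$ and $p(x)\le 0$ for all $x\in\mathbf{B}$.
   Context: Notation. For a polynomial $p\in\mathbb{R}[\mathbf{x}]$, $\|p\|=\max_{x\in[-1,1]^n}|p(x)|$. For a finite set $\mathbf{f}=\{f_1,\dots,f_t\}\subset\mathbb{R}[\mathbf{x}]$, $\mathcal{S}(\mathbf{f})=\{x\in\mathbb{R}^n : f_i(x)\ge 0 \text{ for all } i\}$, $\deg(\mathbf{f})=\max_i \deg(f_i)$, and the quadratic module generated by $\mathbf{f}$ is $\mathcal{Q}(\mathbf{f})=\{s_0+\sum_{i=1}^t s_i f_i : s_0,\dots,s_t\in\Sigma\}$, where $\Sigma$ is the set of sums of squares of polynomials in $\mathbb{R}[\mathbf{x}]$. The Euclidean distance between sets $X,Y\subset\mathbb{R}^n$ is $\mathrm{dist}(X,Y)=\inf_{x\in X,\,y\in Y}|x-y|$. Lojasiewicz coefficient and exponent. For a finite set $\mathbf{f}=\{f_1,\dots,f_t\}$ with $\mathcal{S}(\mathbf{f})\neq\emptyset$, these are constants $\mathfrak{c}>0$ and $T>0$ such that $$\mathrm{dist}(x,\mathcal{S}(\mathbf{f}))^{T}\le \mathfrak{c}\,\bigl|\min\{f_1(x),\dots,f_t(x),0\}\bigr|\qquad\text{for all } x\in[-1,1]^n .$$ In the claim, one pair $(\mathfrak{c},T)$ is used for which this inequality holds both for $\mathbf{f}=\mathbf{g}$ and for $\mathbf{f}=\mathbf{h}$. Constant $\gamma$. For $\mathbf{f}=\{f_1,\dots,f_t\}$, $\gamma(n,\mathbf{f})=n^{3}\,2^{5nT}\,t^{n}\,\mathfrak{c}^{2n}\,\deg(\mathbf{f})^{n}$;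 thus $t=r$ for $\mathbf{f}=\mathbf{g}$ and $t=s$ for $\mathbf{f}=\mathbf{h}$. Constant $C$. The modulus of continuity of a function $f$ on $[-1,1]^n$ is $\omega_f(\delta)=\sup_{|x-y|<\delta}|f(x)-f(y)|$, with $x,y$ in the domain of $f$. $C$ denotes an absolute constant for which the multivariate Jackson theorem holds: for every continuous function $f:[-1,1]^n\to\mathbb{R}$ and every $m\in\mathbb{N}$ (with $m\geq 1$) there is a polynomial $p_m$ of degree at most $m$ such that $|f(x)-p_m(x)|\le C\,\omega_f\left(\frac{n^{3/2}}{m}\right)$ for all $x\in[-1,1]^n$. *)

(* Defs.v *)
From mathcomp Require Import all_boot all_order all_algebra.
From mathcomp Require Import all_classical all_reals all_analysis.
(* The notations of mpoly clash with those of MathComp-Analysis, hence the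
   bare type [mpoly n R] instead of its usual notation. *)
From mathcomp Require Import -(notations) mpoly.

Set Implicit Arguments.
Unset Strict Implicit.
Unset Printing Implicit Defensive.

Import Order.TTheory GRing.Theory Num.Theory.
Import numFieldNormedType.Exports.

Local Open Scope classical_set_scope.
Local Open Scope ring_scope.

Section Geometry.
Context {R : realType} {n : nat}.

(* The library norm on 'rV[R]_n is the sup norm; it induces the same topology. *)
Definition euclid_norm (x : 'rV[R]_n) : R := Num.sqrt (\sum_(i < n) x 0 i ^+ 2).

Definition euclid_dist (X Y : set 'rV[R]_n) : R :=
  inf [set euclid_norm (x - y) | x in X & y in Y].

Definition cube : set 'rV[R]_n := [set x | forall i, -1 <= x 0 i <= 1].

Definition modulus (f : 'rV[R]_n -> R) (delta : R) : R :=
  sup [set d | exists x y, [/\ cube x, cube y, euclid_norm (x - y) < delta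
                             & d = `|f x - f y|]].

End Geometry.

Arguments cube : clear implicits.

Section Polynomials.
Context {R : realType} {n : nat}.
Implicit Types p q : mpoly n R.

Definition peval p (x : 'rV[R]_n) : R := meval (fun i => x 0 i) p.

(* [msize p] is 1 + the total degree; with this truncation deg 0 = 0. *)
Definition pdeg p : nat := (msize p).-1.

Definition cube_norm p : R := sup [set `|peval p x| | x in cube R n].

Definition sos p : Prop :=
  exists qs : seq (mpoly n R), p = \sum_(q <- qs) q ^+ 2.

Section Families.
Context {t : nat} (f : 'I_t -> mpoly n R).

Definition semialg : set 'rV[R]_n := [set x | forall i, 0 <= peval (f i) x].

Definition family_deg : nat := \max_(i < t) pdeg (f i).

Definition quadratic_module p : Prop :=
  exists (s0 : mpoly n R) (s : 'I_t -> mpoly n R),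
    [/\ sos s0, forall i, sos (s i) & p = s0 + \sum_(i < t) s i * f i].

(* The iterated minimum starts from 0, so it is min {f_1(x), ..., f_t(x), 0}. *)
Definition lojasiewicz (c T : R) : Prop :=
  [/\ 0 < c, 0 < T
    & forall x, cube R n x ->
        euclid_dist [set x] semialg `^ T
          <= c * `| \big[Num.min/0]_(i < t) peval (f i) x | ].

Definition gamma (c T : R) : R :=
  n%:R ^+ 3 * 2 `^ (5 * n%:R * T) * t%:R ^+ n * c ^+ (2 * n)
    * family_deg%:R ^+ n.

End Families.

Definition one_minus_sqnorm : mpoly n R :=
  1 - \sum_(i < n) mpolyX R (mnm1 i) ^+ 2.

Definition separating (A B : set 'rV[R]_n) p : Prop :=
  (forall x, A x -> 1 <= peval p x) /\ (forall x, B x -> peval p x <= 0).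

End Polynomials.

Arguments one_minus_sqnorm : clear implicits.

(* C is absolute: the same C serves all dimensions, functions and degrees. *)
Definition jackson_constant {R : realType} (C : R) : Prop :=
  forall (n : nat) (f : 'rV[R]_n -> R) (m : nat),
    (0 < n)%N -> (0 < m)%N -> {within cube R n, continuous f} ->
    exists p : mpoly n R, (pdeg p <= m)%N /\
      forall x, cube R n x ->
        `|f x - peval p x| <= C * modulus f (n%:R `^ (3 / 2) / m%:R).

(* Main.v *)
(* The function 2 dist(x, B) / D - 1/2, D = dist(A, B), which is at least
   3/2 on A and equal to -1/2 on B, is Lipschitz with
   constant 2 / D, so Jackson's theorem in degree l >= 8 C n^(3/2) / D puts a
   polynomial within 1/4 of it. That the assumed bound on l exceeds this
   quantity uses 1/2 <= C (test Jackson's theorem on 2|x| - 1), 1 <= T (the g_i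
   are Lipschitz), 2 D^T <= c (evaluate the Lojasiewicz inequality at a point of
   B, where |g_i| <= 1/2) and D <= 2 (both sets lie in the unit ball). *)
Require Import Defs.
From mathcomp Require Import all_boot all_order all_algebra.
From mathcomp Require Import all_classical all_reals all_analysis.
From mathcomp Require Import -(notations) mpoly.
From mathcomp Require Import ring lra.
Set Implicit Arguments.
Unset Strict Implicit.
Unset Printing Implicit Defensive.

Import Order.TTheory GRing.Theory Num.Theory.
Import numFieldNormedType.Exports.

Local Open Scope classical_set_scope.
Local Open Scope ring_scope.

(** * Cauchy-Schwarz and the Euclidean norm *)

Lemma cauchy_schwarz (R : rcfType) (I : finType) (a b : I -> R) :
  \sum_i a i * b i
    <= Num.sqrt (\sum_i a i ^+ 2) * Num.sqrt (\sum_i b i ^+ 2).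
Proof.
have sq_ge0 (u : I -> R) : 0 <= \sum_i u i ^+ 2.
  by apply: sumr_ge0 => i _; rewrite sqr_ge0.
have null (u v : I -> R) : \sum_i u i ^+ 2 = 0 -> \sum_i u i * v i = 0.
  move=> /psumr_eq0P u0; apply: big1 => i _.
  have /eqP := u0 (fun j _ => sqr_ge0 (u j)) i isT.
  by rewrite sqrf_eq0 => /eqP ->; rewrite mul0r.
set p := Num.sqrt _; set q := Num.sqrt _.
have [a0|a_neq0] := eqVneq (\sum_i a i ^+ 2) 0.
  by rewrite (null _ _ a0) mulr_ge0 ?sqrtr_ge0.
have [b0|b_neq0] := eqVneq (\sum_i b i ^+ 2) 0.
  under eq_bigr do rewrite mulrC.
  by rewrite (null _ _ b0) mulr_ge0 ?sqrtr_ge0.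
have p_gt0 : 0 < p by rewrite sqrtr_gt0 lt_neqAle eq_sym a_neq0 sq_ge0.
have q_gt0 : 0 < q by rewrite sqrtr_gt0 lt_neqAle eq_sym b_neq0 sq_ge0.
have p2 : \sum_i a i ^+ 2 = p ^+ 2 by rewrite sqr_sqrtr ?sq_ge0.
have q2 : \sum_i b i ^+ 2 = q ^+ 2 by rewrite sqr_sqrtr ?sq_ge0.
(* With [p] and [q] the two norms, expanding this sum of squares gives
   [2 p q (p q - \sum_i a i * b i)], and [p q > 0] can be divided out. *)
have : 0 <= \sum_i (q * a i - p * b i) ^+ 2 by exact: sq_ge0.
have -> : \sum_i (q * a i - p * b i) ^+ 2 =
    2 * (p * q) * (p * q - \sum_i a i * b i).
  transitivity (q ^+ 2 * \sum_i a i ^+ 2 - 2 * (p * q) * \sum_i a i * b i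
      + p ^+ 2 * \sum_i b i ^+ 2); last by rewrite p2 q2; ring.
  rewrite !mulr_sumr -sumrB -big_split /=.
  by apply: eq_bigr => i _; ring.
by rewrite pmulr_rge0 ?subr_ge0 // mulr_gt0 // mulr_gt0.
Qed.

Lemma euclid_norm_ge0 (R : realType) n (x : 'rV[R]_n) : 0 <= euclid_norm x.
Proof. exact: sqrtr_ge0. Qed.

Lemma sqr_euclid_norm (R : realType) n (x : 'rV[R]_n) :
  euclid_norm x ^+ 2 = \sum_(i < n) x 0 i ^+ 2.
Proof. by rewrite sqr_sqrtr // sumr_ge0 // => i _; rewrite sqr_ge0. Qed.

Lemma euclid_norm0 (R : realType) n : euclid_norm (0 : 'rV[R]_n) = 0.
Proof. by rewrite /euclid_norm big1 ?sqrtr0 // => i _; rewrite mxE expr0n. Qed.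

Lemma euclid_normN (R : realType) n (x : 'rV[R]_n) :
  euclid_norm (- x) = euclid_norm x.
Proof.
by congr Num.sqrt; apply: eq_bigr => i _; rewrite mxE sqrrN.
Qed.

Lemma euclid_distrC (R : realType) n (x y : 'rV[R]_n) :
  euclid_norm (x - y) = euclid_norm (y - x).
Proof. by rewrite -euclid_normN opprB. Qed.

Lemma euclid_normZ (R : realType) n (a : R) (x : 'rV[R]_n) :
  euclid_norm (a *: x) = `|a| * euclid_norm x.
Proof.
rewrite /euclid_norm -(sqrtr_sqr a) -sqrtrM ?sqr_ge0 // mulr_sumr.
by congr Num.sqrt; apply: eq_bigr => i _; rewrite mxE exprMn.
Qed.

Lemma ler_euclid_normD (R : realType) n (x y : 'rV[R]_n) :
  euclid_norm (x + y) <= euclid_norm x + euclid_norm y.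
Proof.
rewrite -(@ler_pXn2r _ 2) ?nnegrE ?addr_ge0 ?euclid_norm_ge0 //.
rewrite sqr_euclid_norm sqrrD !sqr_euclid_norm.
have -> : \sum_i (x + y) 0 i ^+ 2 = \sum_i x 0 i ^+ 2
    + (\sum_i x 0 i * y 0 i) *+ 2 + \sum_i y 0 i ^+ 2.
  rewrite -mulr_natl mulr_sumr -!big_split /=.
  by apply: eq_bigr => i _; rewrite mxE; ring.
by rewrite lerD2r lerD2l lerMn2r cauchy_schwarz.
Qed.

Lemma ler_euclid_distD (R : realType) n (y x z : 'rV[R]_n) :
  euclid_norm (x - z) <= euclid_norm (x - y) + euclid_norm (y - z).
Proof. by rewrite (le_trans _ (ler_euclid_normD _ _)) // addrA subrK. Qed.

Lemma ler_coord_euclid_norm (R : realType) n (x : 'rV[R]_n) i :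
  `|x 0 i| <= euclid_norm x.
Proof.
rewrite -sqrtr_sqr ler_wsqrtr // (bigD1 i) //= lerDl sumr_ge0 // => j _.
exact: sqr_ge0.
Qed.

Lemma ler_coord_mx_norm (R : realType) n (x : 'rV[R]_n) i : `|x 0 i| <= `|x|.
Proof.
rewrite [leRHS]/Num.norm /= mx_normrE.
exact: (le_bigmax _ (fun ij => `|x ij.1 ij.2|) (0, i)).
Qed.

(** The crude factor [n], instead of its square root, suffices for transferring continuity to the
    topology of the sup norm. *)
Lemma ler_euclid_mx_norm (R : realType) n (x : 'rV[R]_n) :
  euclid_norm x <= n%:R * `|x|.
Proof.
have le_n : (n%:R : R) <= n%:R ^+ 2.
  by rewrite -natrX ler_nat; case: n {x} => // n; rewrite leq_pmulr.
rewrite -(@ler_pXn2r _ 2) ?nnegrE ?euclid_norm_ge0 ?mulr_ge0 //.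
rewrite sqr_euclid_norm exprMn (le_trans _ (ler_wpM2r (sqr_ge0 _) le_n)) //.
rewrite mulr_natl -[X in _ *+ X]card_ord -sumr_const ler_sum // => i _.
by rewrite -real_normK ?num_real // lerXn2r ?nnegrE ?ler_coord_mx_norm.
Qed.

Lemma euclid_lipschitz_continuous (R : realType) n (f : 'rV[R]_n -> R) (K : R) :
  (forall x y, `|f x - f y| <= K * euclid_norm (x - y)) -> continuous f.
Proof.
move=> fK x; apply/(@cvgrPdist_le _ _ _ (nbhs x) (nbhs_filter x)) => /= e e_gt0.
(* [K] may have any sign, hence the absolute value; the added 1 makes [k] positive, so that [e / k]
   is a valid radius. *)
set k := `|K| * n%:R + 1.
have k_gt0 : 0 < k by rewrite ltr_pwDr // mulr_ge0.
apply: filterS (nbhsx_ballx x (e / k) (divr_gt0 e_gt0 k_gt0)) => y.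
rewrite mx_norm_ball /ball_ /= => /ltW xy.
apply: (le_trans (fK x y)); move: xy.
rewrite ler_pdivlMr // => xy; apply: le_trans xy.
have := ler_euclid_mx_norm (x - y); have := euclid_norm_ge0 (x - y).
have := normr_ge0 (x - y); have := ler_norm K; have := normr_ge0 K.
set a := `|x - y|; rewrite /k => *.
apply: (@le_trans _ _ (`|K| * (n%:R * a))); last by nra.
by rewrite (@le_trans _ _ (`|K| * euclid_norm (x - y))) ?ler_wpM2r ?ler_wpM2l.
Qed.

(** * Distance between sets *)

Lemma euclid_dist_le (R : realType) n (X Y : set 'rV[R]_n) x y :
  X x -> Y y -> euclid_dist X Y <= euclid_norm (x - y).
Proof.
move=> Xx Yy; apply: ge_inf; last by exists x => //; exists y.
by exists 0 => _ [u _ [v _ <-]]; exact: euclid_norm_ge0.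
Qed.

Lemma euclid_dist_ge (R : realType) n (X Y : set 'rV[R]_n) (d : R) :
  X !=set0 -> Y !=set0 ->
  (forall x y, X x -> Y y -> d <= euclid_norm (x - y)) -> d <= euclid_dist X Y.
Proof.
move=> [x Xx] [y Yy] le_d; apply: lb_le_inf.
  by exists (euclid_norm (x - y)), x => //; exists y.
by move=> _ [u Xu [v Yv <-]]; exact: le_d.
Qed.

Lemma euclid_dist_ge0 (R : realType) n (X Y : set 'rV[R]_n) :
  X !=set0 -> Y !=set0 -> 0 <= euclid_dist X Y.
Proof. by move=> X0 Y0; apply: euclid_dist_ge => // *; exact: euclid_norm_ge0. Qed.

Lemma euclid_dist1_lipschitz (R : realType) n (S : set 'rV[R]_n) x y :
  S !=set0 ->
  `|euclid_dist [set x] S - euclid_dist [set y] S| <= euclid_norm (x - y).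
Proof.
move=> S0; have half u v :
    euclid_dist [set u] S <= euclid_norm (u - v) + euclid_dist [set v] S.
  rewrite -lerBlDl; apply: euclid_dist_ge => //; first by exists v.
  move=> _ z -> Sz; rewrite lerBlDl.
  exact: le_trans (euclid_dist_le erefl Sz) (ler_euclid_distD v _ _).
by rewrite ler_norml lerBlDr half lerBrDl -lerBrDr opprK addrC
  euclid_distrC half.
Qed.

Lemma euclid_dist1_continuous (R : realType) n (S : set 'rV[R]_n) :
  S !=set0 -> continuous (fun x => euclid_dist [set x] S).
Proof.
move=> S0; apply: (@euclid_lipschitz_continuous _ _ _ 1) => x y.
by rewrite mul1r euclid_dist1_lipschitz.
Qed.

Lemma euclid_dist1_eq0 (R : realType) n (S : set 'rV[R]_n) x :
  S x -> euclid_dist [set x] S = 0.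
Proof.
move=> Sx; apply/le_anti.
rewrite euclid_dist_ge0; [|by exists x..].
by rewrite andbT -(euclid_norm0 R n) -(subrr x) euclid_dist_le.
Qed.

(** Some sup-norm ball around [x] misses [S]. The Euclidean norm dominates the sup norm, so the
    radius of this ball bounds the distance from below. *)
Lemma euclid_dist1_gt0 (R : realType) n (S : set 'rV[R]_n) x :
  S !=set0 -> closed S -> ~ S x -> 0 < euclid_dist [set x] S.
Proof.
move=> S0 Scl Sx.
have /(_ x Sx) : open (~` S) by rewrite openC.
rewrite -nbhs_ballE => -[e /= e_gt0 eS].
apply: (lt_le_trans e_gt0); apply: euclid_dist_ge => //; first by exists x.
move=> _ y -> Sy; rewrite leNgt; apply/negP => lt_e.
apply: (eS y _ Sy); split => // i j; rewrite (ord1 i) /ball /= ?mxE.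
apply: le_lt_trans lt_e; have := ler_coord_euclid_norm (x - y) j.
by rewrite !mxE.
Qed.

(** The continuous function [dist(x, Y)] attains its minimum on the compact [X], at a point outside
    the closed set [Y]. *)
Lemma euclid_dist_compact_gt0 (R : realType) n (X Y : set 'rV[R]_n) :
  X !=set0 -> Y !=set0 -> compact X -> closed Y -> X `&` Y = set0 ->
  0 < euclid_dist X Y.
Proof.
move=> X0 Y0 Xc Ycl XY.
have [|x /set_mem Xx xmin] :=
    @compact_EVT_min _ R (fun x => euclid_dist [set x] Y) X X0 Xc.
  exact/continuous_subspaceT/euclid_dist1_continuous.
apply: (@lt_le_trans _ _ (euclid_dist [set x] Y)).
  apply: euclid_dist1_gt0 => // Yx.
  by have : (X `&` Y) x by []; rewrite XY.
apply: euclid_dist_ge => // u v Xu Yv.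
exact: le_trans (xmin u (mem_set Xu)) (euclid_dist_le erefl Yv).
Qed.

(** * Lipschitz bounds for polynomials on the cube *)

(** Boundedness is part of the notion because products of Lipschitz functions are Lipschitz only
    under bounds on the factors. *)
Definition cube_lipschitz (R : realType) n (F : 'rV[R]_n -> R) : Prop :=
  exists2 K, 0 <= K & forall x y, cube R n x -> cube R n y ->
    `|F x| <= K /\ `|F x - F y| <= K * euclid_norm (x - y).

Lemma cube_lipschitz_cst (R : realType) n (a : R) :
  cube_lipschitz (fun _ : 'rV[R]_n => a).
Proof.
exists `|a| => // x y _ _; rewrite subrr normr0; split => //.
by rewrite mulr_ge0 ?euclid_norm_ge0.
Qed.

Lemma cube_lipschitz_coord (R : realType) n (i : 'I_n) :
  cube_lipschitz (fun x : 'rV[R]_n => x 0 i).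
Proof.
exists 1 => // x y cx cy; split; first by rewrite ler_norml cx.
by rewrite mul1r (le_trans _ (ler_coord_euclid_norm _ i)) ?mxE.
Qed.

Lemma cube_lipschitzD (R : realType) n (F G : 'rV[R]_n -> R) :
  cube_lipschitz F -> cube_lipschitz G -> cube_lipschitz (fun x => F x + G x).
Proof.
move=> [K K0 FK] [L L0 GL]; exists (K + L); first exact: addr_ge0.
move=> x y cx cy; have [F1 F2] := FK x y cx cy; have [G1 G2] := GL x y cx cy.
split; first by rewrite (le_trans (ler_normD _ _)) // lerD.
rewrite mulrDl opprD addrACA (le_trans (ler_normD _ _)) //.
by rewrite lerD.
Qed.

Lemma cube_lipschitzM (R : realType) n (F G : 'rV[R]_n -> R) :
  cube_lipschitz F -> cube_lipschitz G -> cube_lipschitz (fun x => F x * G x).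
Proof.
move=> [K K0 FK] [L L0 GL].
exists (K * L + (K * L + L * K)); first by rewrite !addr_ge0 // mulr_ge0.
move=> x y cx cy; have [F1 F2] := FK x y cx cy; have [G1 G2] := GL x y cx cy.
have [F3 _] := FK y x cy cx.
split.
  rewrite normrM ler_wpDr ?addr_ge0 ?mulr_ge0 //.
  by rewrite ler_pM.
have -> : F x * G x - F y * G y = (F x - F y) * G x + F y * (G x - G y).
  by ring.
apply: (le_trans (ler_normD _ _)); rewrite !normrM.
apply: (@le_trans _ _ ((K * euclid_norm (x - y)) * L
    + K * (L * euclid_norm (x - y)))); first by rewrite lerD // ler_pM.
have := mulr_ge0 (mulr_ge0 K0 L0) (euclid_norm_ge0 (x - y)); lra.
Qed.

(** Constants and coordinates have the property, and sums and products preserve it; the inductions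
    run over terms, then variables, then exponents. *)
Lemma peval_cube_lipschitz (R : realType) n (p : mpoly n R) :
  cube_lipschitz (peval p).
Proof.
elim/mpolyind: p => [|a m p _ _ IHp].
  rewrite (_ : peval 0 = fun=> 0) /peval; first exact: cube_lipschitz_cst.
  by apply/funext => x; rewrite meval0.
rewrite (_ : peval (a *: mpolyX R m + p) =
    fun x => a * (\prod_(i < n) x 0 i ^+ m i) + peval p x); last first.
  by apply/funext => x; rewrite /peval mevalD mevalZ mevalX.
apply: cube_lipschitzD => //; apply: cube_lipschitzM.
  exact: cube_lipschitz_cst.
elim: (index_enum _) => [|i s IHs].
  under eq_fun do rewrite big_nil; exact: cube_lipschitz_cst.
under eq_fun do rewrite big_cons.
apply: cube_lipschitzM => //.
elim: (m i) => [|k IHk].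
  under eq_fun do rewrite expr0; exact: cube_lipschitz_cst.
under eq_fun do rewrite exprS.
by apply: cube_lipschitzM => //; exact: cube_lipschitz_coord.
Qed.

(** A supremum bounds its set only if the set is bounded above; the preceding Lipschitz property
    provides that bound. *)
Lemma peval_le_cube_norm (R : realType) n (p : mpoly n R) x :
  cube R n x -> `|peval p x| <= cube_norm p.
Proof.
move=> cx; apply: ub_le_sup; last by exists x.
have [K _ pK] := peval_cube_lipschitz p.
by exists K => _ [y cy <-]; have [] := pK y y cy cy.
Qed.

(** * Constraints on the Lojasiewicz coefficient and exponent *)

Lemma cube_segment (R : realType) n (a b : 'rV[R]_n) t :
  cube R n a -> cube R n b -> 0 <= t <= 1 -> cube R n (a + t *: (b - a)).
Proof.
move=> ca cb t01 i; rewrite !mxE.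
by have := ca i; have := cb i; nra.
Qed.

(** The minimum starts from 0 and is therefore nonpositive, so lower bounds on the [F i] control its
    absolute value. *)
Lemma normr_bigmin0_le (R : realType) t (F : 'I_t -> R) (M : R) :
  0 <= M -> (forall i, - M <= F i) -> `|\big[Num.min/0]_(i < t) F i| <= M.
Proof.
move=> M0 FM; rewrite ler0_norm ?bigmin_le_id // lerNl.
by apply: le_bigmin => //; rewrite oppr_le0.
Qed.

Lemma lojasiewicz_coef_ge (R : realType) n t (f : 'I_t -> mpoly n R)
    (c T D : R) x :
  lojasiewicz f c T -> (forall i, cube_norm (f i) <= 1 / 2) -> cube R n x ->
  0 <= D <= euclid_dist [set x] (semialg f) -> D `^ T <= c / 2.
Proof.
move=> [c_gt0 T_gt0 loj] f_norm cx /andP[D_ge0 D_le].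
apply: (@le_trans _ _ (euclid_dist [set x] (semialg f) `^ T)).
  by rewrite ge0_ler_powR ?nnegrE ?(ltW T_gt0) // (le_trans D_ge0).
apply: (le_trans (loj x cx)); rewrite ler_wpM2l //; first exact: ltW.
apply: normr_bigmin0_le => [|i]; first by rewrite invr_ge0.
have := le_trans (peval_le_cube_norm (f i) cx) (f_norm i).
by rewrite ler_norml div1r => /andP[].
Qed.

(** The sum of the individual constants dominates each of them and serves the whole family. *)
Lemma family_cube_lipschitz (R : realType) n t (f : 'I_t -> mpoly n R) :
  exists2 L, 0 <= L & forall i x y, cube R n x -> cube R n y ->
    `|peval (f i) x - peval (f i) y| <= L * euclid_norm (x - y).
Proof.
have {}fL i := peval_cube_lipschitz (f i).
exists (\sum_i sval (cid2 (fL i))) => [|i x y cx cy].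
  by apply: sumr_ge0 => i _; case: cid2.
have le_sum : sval (cid2 (fL i)) <= \sum_j sval (cid2 (fL j)).
  rewrite (bigD1 i) //= lerDl sumr_ge0 // => j _; by case: (cid2 (fL j)).
apply: le_trans (ler_wpM2r (euclid_norm_ge0 _) le_sum).
by case: (cid2 (fL i)) => K /= _ /(_ x y cx cy) [].
Qed.

(* Near its zero set a Lipschitz function decays at least linearly, and along a
   segment leaving [semialg f] the distance takes arbitrarily small positive
   values. *)
Lemma lojasiewicz_exponent_ge1 (R : realType) n t (f : 'I_t -> mpoly n R)
    (c T : R) b :
  lojasiewicz f c T -> semialg f !=set0 -> semialg f `<=` cube R n ->
  cube R n b -> 0 < euclid_dist [set b] (semialg f) -> 1 <= T.
Proof.
move=> [c_gt0 T_gt0 loj] S0 Scube cb; set S := semialg f in S0 Scube loj *.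
pose dS x := euclid_dist [set x] S; rewrite -/(dS b) => D_gt0.
have [L L_ge0 fL] := family_cube_lipschitz f.
(* Comparison with points of [S], where all [f i] are nonnegative, bounds the truncated minimum by
   [L * dS x]. The added 1 keeps the factor positive even if [L = 0]. *)
have dS_le x : cube R n x -> dS x `^ T <= (c * L + 1) * dS x.
  move=> cx; have dS_ge0 : 0 <= dS x by apply: euclid_dist_ge0 => //; exists x.
  suff min_le : `|\big[Num.min/0]_(i < t) peval (f i) x| <= L * dS x.
    apply: (le_trans (loj x cx)); rewrite mulrDl mul1r -mulrA.
    by rewrite (le_trans (ler_wpM2l (ltW c_gt0) min_le)) // lerDl.
  (* If [L = 0], every [f i] is constant on the cube and inherits its sign from a point of [S].
     Otherwise dividing by [L] leaves a lower bound on an infimum. *)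
  have [L_eq0|L_neq0] := eqVneq L 0.
    rewrite L_eq0 mul0r; have [y Sy] := S0.
    apply: normr_bigmin0_le => // i; rewrite oppr0.
    have := fL i x y cx (Scube y Sy).
    by rewrite L_eq0 mul0r normr_le0 subr_eq0 => /eqP ->; exact: Sy.
  have L_gt0 : 0 < L by rewrite lt_neqAle eq_sym L_neq0.
  rewrite -ler_pdivrMl //; apply: euclid_dist_ge => //; first by exists x.
  move=> _ y -> Sy; rewrite ler_pdivrMl //; apply: normr_bigmin0_le => [|i].
    by rewrite mulr_ge0 ?euclid_norm_ge0.
  have := fL i x y cx (Scube y Sy); rewrite ler_norml => /andP[+ _].
  by move=> /le_trans; apply; rewrite gerBl; exact: Sy.
have K_gt0 : 0 < c * L + 1 by rewrite ltr_pwDr // mulr_ge0 // ltW.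
set K := c * L + 1 in dS_le K_gt0.
(* Intermediate values of [dS] along the segment from a point [a] of [S], where it is 0, to [b]. *)
have dS_onto (e : R) : 0 <= e <= dS b -> exists2 x, cube R n x & dS x = e.
  move=> /andP[e_ge0 e_le]; have [a Sa] := S0.
  pose u s := dS (a + s *: (b - a)).
  have u_cont : continuous u.
    move=> s; apply/cvgrPdist_le => /= d d_gt0; pose k := euclid_norm (b - a) + 1.
    have k_gt0 : 0 < k by rewrite ltr_pwDr ?euclid_norm_ge0.
    near=> s'.
    apply: (le_trans (euclid_dist1_lipschitz _ _ S0)).
    rewrite opprD addrACA subrr add0r -scalerBl euclid_normZ.
    have : `|s - s'| <= d / k.
      by near: s'; apply: cvgr_dist_le => //; rewrite divr_gt0.
    rewrite ler_pdivlMr // => sk; apply: le_trans sk.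
    by rewrite ler_wpM2l // lerDl.
  have u0 : u 0 = 0 by rewrite /u scale0r addr0 /dS euclid_dist1_eq0.
  have u1 : u 1 = dS b by rewrite /u scale1r addrC subrK.
  have [||s s01 us] := @IVT R u 0 1 e ler01.
  - exact: continuous_subspaceT.
  - rewrite u0 u1 (min_idPl _) ?(max_idPr _) ?e_ge0 //; exact: ltW.
  exists (a + s *: (b - a)) => //; apply: cube_segment => //.
  exact: Scube.
rewrite leNgt; apply/negP => T_lt1.
have T1_gt0 : 0 < 1 - T by rewrite subr_gt0.
(* The second term gives [e^(1-T) <= 1/(2K)], hence [K e = K e^T e^(1-T) <= e^T / 2], against
   [e^T <= K e]. The first keeps [e] among the values of [dS] on the segment. *)
pose e := Num.min (dS b) ((K * 2)^-1 `^ (1 - T)^-1).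
have K2_gt0 : 0 < (K * 2)^-1 by rewrite invr_gt0 mulr_gt0.
have e_gt0 : 0 < e by rewrite lt_min D_gt0 powR_gt0.
have [|x cx dx] := dS_onto e; first by rewrite ltW //= ge_min lexx.
have := dS_le x cx; rewrite dx [in leRHS](_ : e = e `^ T * e `^ (1 - T)); last first.
  rewrite -powRD; last by rewrite (gt_eqF e_gt0) implybT.
  by rewrite addrC subrK powRr1 // ltW.
have : e `^ (1 - T) <= (K * 2)^-1.
  have -> : (K * 2)^-1 = ((K * 2)^-1 `^ (1 - T)^-1) `^ (1 - T).
    by rewrite -powRrM mulVf ?powRr1 ?ltW // gt_eqF.
  by rewrite ge0_ler_powR ?nnegrE ?ge_min ?lexx ?orbT ?powR_ge0 // ltW.
rewrite -div1r ler_pdivlMr ?mulr_gt0 //.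
have := powR_gt0 T e_gt0; set P := e `^ T; set Q := e `^ (1 - T).
by nra.
Unshelve. all: by end_near. Qed.

(** * Consequences of the normalization and degree positivity *)

Lemma sos_peval_ge0 (R : realType) n (p : mpoly n R) x :
  sos p -> 0 <= peval p x.
Proof.
move=> [qs ->]; rewrite /peval raddf_sum sumr_ge0 // => q _.
by rewrite /= rmorphXn sqr_ge0.
Qed.

Lemma quadratic_module_peval_ge0 (R : realType) n t (f : 'I_t -> mpoly n R) p x :
  quadratic_module f p -> semialg f x -> 0 <= peval p x.
Proof.
move=> [s0 [s [s0_sos s_sos ->]]] fx; rewrite /peval mevalD addr_ge0 //.
  exact: sos_peval_ge0.
rewrite raddf_sum sumr_ge0 // => i _; rewrite /= mevalM mulr_ge0 //.
  exact: sos_peval_ge0.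
exact: fx.
Qed.

Lemma semialg_euclid_norm_le1 (R : realType) n t (f : 'I_t -> mpoly n R) x :
  quadratic_module f (one_minus_sqnorm R n) -> semialg f x ->
  euclid_norm x <= 1.
Proof.
move=> Qf fx; have := quadratic_module_peval_ge0 Qf fx.
rewrite /peval mevalB meval1 subr_ge0 raddf_sum => le1.
rewrite -sqrtr1 ler_wsqrtr // (le_trans _ le1) // ler_sum // => i _.
by rewrite /= rmorphXn /= mevalXU.
Qed.

(** Constant polynomials would make [semialg f] empty or the whole space. Positivity keeps the
    degree factor of [gamma] at least 1. *)
Lemma family_deg_gt0 (R : realType) n t (f : 'I_t -> mpoly n R) b :
  semialg f !=set0 -> ~ semialg f b -> (0 < family_deg f)%N.
Proof.
move=> [a fa] fb; rewrite lt0n; apply/negP => /eqP deg0; apply: fb => i.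
have : (pdeg (f i) <= family_deg f)%N by exact: leq_bigmax.
rewrite deg0 leqn0 /pdeg => /eqP size1; have := fa i.
(* Since [pdeg] truncates, degree 0 covers both size 0 (the zero polynomial) and size 1. *)
have /msize1_polyC -> : (mmeasure mdeg (f i) <= 1)%N.
  by move: size1; case: mmeasure => [|[]].
by rewrite /peval !mevalC.
Qed.

(** * Jackson approximation, its constant, and exact degrees *)

Lemma modulus_le (R : realType) n (f : 'rV[R]_n -> R) (d M : R) :
  0 <= M ->
  (forall x y, cube R n x -> cube R n y -> euclid_norm (x - y) < d ->
     `|f x - f y| <= M) ->
  modulus f d <= M.
Proof.
move=> M0 fM; rewrite /modulus; set E := [set _ | _].
(* No pair of points may satisfy the constraint, in which case the supremum takes the default value
   0 and [0 <= M] is what applies. *)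
have [->|E0] := eqVneq E set0; first by rewrite sup0.
by apply: ge_sup; [exact/set0P | move=> _ [x [y [cx cy xy ->]]]; exact: fM].
Qed.

(** Monomials of degree 1 are odd and cancel, while the constant monomial counts twice on both
    sides. *)
Lemma pdeg_le1_affine (R : realType) n (p : mpoly n R) x :
  (pdeg p <= 1)%N -> peval p x + peval p (- x) = peval p 0 + peval p 0.
Proof.
move=> deg_p; rewrite /peval !mevalE -!big_split /=.
apply: eq_big_seq => m /msize_mdeg_lt lt_m; rewrite -!mulrDr; congr (_ * _).
have : (mdeg m <= 1)%N.
  by rewrite -ltnS (leq_trans lt_m) // (leq_trans (leqSpred _)).
rewrite leq_eqVlt ltnS leqn0 mdeg_eq0 => /orP[/mdeg1P[i /eqP ->]|/eqP ->].
  by rewrite -!(mevalX _ (mnm1 i)) !mevalXU !mxE subrr addr0.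
by rewrite -!(mevalX _ mnm0) mpolyX0 !meval1.
Qed.

(* No affine function comes closer than 1 to [2 * |x| - 1] on [-1, 1], whose
   oscillation is 2. *)
Lemma jackson_constant_ge_half (R : realType) (C : R) :
  jackson_constant C -> 1 / 2 <= C.
Proof.
move=> jC; pose f (x : 'rV[R]_1) := 2 * `|x 0 0| - 1.
have fE (a : R) : f (const_mx a) = 2 * `|a| - 1 by rewrite /f mxE.
have f_cont : continuous f.
  apply: (@euclid_lipschitz_continuous _ _ _ 2) => x y.
  rewrite /f opprD opprK addrACA addNr addr0 -mulrBr normrM ger0_norm //.
  rewrite ler_wpM2l // (le_trans (ler_dist_dist _ _)) //.
  by have := ler_coord_euclid_norm (x - y) 0; rewrite !mxE.
have [//|//||p [deg_p f_p]] := jC 1%N f 1%N; first exact: continuous_subspaceT.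
set d := _ `^ _ / _ in f_p; have d_gt0 : 0 < d by rewrite divr_gt0 ?powR_gt0 ?ltr0n.
have osc x y : cube R 1 x -> cube R 1 y -> `|f x - f y| <= 2.
  move=> /(_ 0) + /(_ 0); rewrite -!ler_norml => cx cy.
  have := normr_ge0 (x 0 0); have := normr_ge0 (y 0 0); rewrite /f => *.
  by apply/ler_normlP; split; lra.
have cst_cube (a : R) : `|a| <= 1 -> cube R 1 (const_mx a).
  by rewrite ler_norml => a1 i; rewrite mxE.
have mod_le : modulus f d <= 2 by apply: modulus_le => // x y cx cy _; exact: osc.
(* The sign of [C] is still unknown, so the final comparison needs the sign of the modulus. *)
have mod_ge0 : 0 <= modulus f d.
  apply: ub_le_sup; first by exists 2 => _ [x [y [cx cy _ ->]]]; exact: osc.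
  exists (const_mx 0), (const_mx 0); rewrite !subrr normr0 euclid_norm0.
  by split => //; apply: cst_cube; rewrite normr0.
have := pdeg_le1_affine (const_mx 1) deg_p.
have -> : - const_mx 1 = const_mx (- 1) :> 'rV[R]_1.
  by apply/rowP => i; rewrite !mxE.
have -> : 0 = const_mx 0 :> 'rV[R]_1 by apply/rowP => i; rewrite !mxE.
have := f_p (const_mx 1); rewrite fE normr1 => /(_ (cst_cube _ _)).
rewrite normr1 => /(_ (lexx _)) /ler_normlP[p1 p1'].
have := f_p (const_mx (- 1)); rewrite fE normrN1 => /(_ (cst_cube _ _)).
rewrite normrN1 => /(_ (lexx _)) /ler_normlP[pN1 pN1'].
have := f_p (const_mx 0); rewrite fE normr0 => /(_ (cst_cube _ _)).
rewrite normr0 => /(_ ler01) /ler_normlP[p0 p0'].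
(* With error [E = C * modulus f d], [p(1)] and [p(-1)] are at least [1 - E] and [p(0)] is at most
   [E - 1]; the midpoint identity then forces [E >= 1]. If [C < 1/2], this pushes the modulus to its
   maximum 2, and [2 C >= 1] is a contradiction. *)
move=> aff; have mod_ge : 1 <= C * modulus f d by lra.
rewrite leNgt; apply/negP => C_lt.
have : modulus f d = 2 by apply/le_anti; rewrite mod_le /=; nra.
by move=> mod_eq; move: mod_ge; rewrite mod_eq; lra.
Qed.

(* Adding a small multiple of [x_i ^ l] makes the degree exactly [l]; the two
   multiples [e] and [e / 2] cannot both cancel the coefficient of [p]. *)
Lemma exists_pdeg_close (R : realType) n (p : mpoly n R) l (e : R) :
  (0 < n)%N -> (pdeg p <= l)%N -> 0 < e ->
  exists2 q : mpoly n R, pdeg q = l &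
    forall x, cube R n x -> `|peval q x - peval p x| <= e.
Proof.
move=> n_gt0 deg_p e_gt0; pose i := Ordinal n_gt0.
pose m := mnm_muln (mnm1 i) l.
have deg_m : mdeg m = l by rewrite mdegMn mdeg1 mul1n.
have [a /andP[a_gt0 a_le] coef_neq0] :
    exists2 a : R, 0 < a <= e & mcoeff m p + a != 0.
  have [pe|] := eqVneq (mcoeff m p + e) 0; last by exists e; rewrite ?e_gt0 /=.
  exists (e / 2); first by apply/andP; split; lra.
  by apply/eqP; lra.
exists (p + a *: mpolyX R m) => [|x cx].
  rewrite /pdeg; set q := p + _.
  suff -> : mmeasure mdeg q = l.+1 by [].
  (* Both summands have size at most [l.+1], and the nonzero coefficient at [m], of degree [l],
     gives the reverse inequality. *)
  apply/anti_leq/andP; split.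
    rewrite (leq_trans (msizeD_le _ _)) // geq_max.
    rewrite (leq_trans (leqSpred _)) //=.
    by rewrite (leq_trans (msizeZ_le _ _)) // msizeX deg_m.
  rewrite -{1}deg_m msize_mdeg_lt // -[_ \in _]negbK -mcoeff_eq0.
  by rewrite mcoeffD mcoeffZ mcoeffX eqxx mulr1.
rewrite /peval mevalD addrAC subrr add0r mevalZ -mpolyXn rmorphXn /= mevalXU.
rewrite normrM gtr0_norm // normrX -[leRHS]mulr1 ler_pM ?exprn_ge0 //.
  exact: ltW.
by rewrite exprn_ile1 // ler_norml cx.
Qed.

(** An error of 1/4 turns the values 3/2 and -1/2 into 5/4 and -1/4. The slack of 1/4 on each side
    leaves room for a later adjustment of the degree. *)
Lemma jackson_separation (R : realType) n (A B : set 'rV[R]_n) (C : R) l :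
  jackson_constant C -> 0 <= C -> (0 < n)%N -> (0 < l)%N ->
  A `<=` cube R n -> B `<=` cube R n -> A !=set0 -> B !=set0 ->
  0 < euclid_dist A B -> 8 * C * n%:R `^ (3 / 2) / euclid_dist A B <= l%:R ->
  exists p : mpoly n R, [/\ (pdeg p <= l)%N, forall x, A x -> 5 / 4 <= peval p x
    & forall x, B x -> peval p x <= - (1 / 4)].
Proof.
move=> jC C_ge0 n_gt0 l_gt0 Acube Bcube A0 B0; set D := euclid_dist A B.
move=> D_gt0 l_ge; pose F x := 2 / D * euclid_dist [set x] B - 1 / 2.
have k_gt0 : 0 < 2 / D by rewrite divr_gt0.
have F_lip x y : `|F x - F y| <= 2 / D * euclid_norm (x - y).
  rewrite /F opprD opprK addrACA addNr addr0 -mulrBr normrM gtr0_norm //.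
  by rewrite ler_wpM2l ?euclid_dist1_lipschitz // ltW.
have [|p [deg_p F_p]] := jC n F l n_gt0 l_gt0.
  exact/continuous_subspaceT/(euclid_lipschitz_continuous F_lip).
have lR_gt0 : 0 < l%:R :> R by rewrite ltr0n.
have err : C * modulus F (n%:R `^ (3 / 2) / l%:R) <= 1 / 4.
  set d := _ `^ _ / _; have d_ge0 : 0 <= d by rewrite divr_ge0 ?powR_ge0.
  apply: (@le_trans _ _ (C * (2 / D * d))).
    apply: ler_wpM2l => //; apply: modulus_le => [|x y _ _ /ltW xy].
      by rewrite mulr_ge0 // ltW.
    by rewrite (le_trans (F_lip x y)) // ler_wpM2l // ltW.
  move: l_ge; rewrite /d; set w := _ `^ _.
  rewrite ler_pdivrMr // => l_ge.
  (* In this form the hypothesis [8 * C * w <= l%:R * D] bounds the fraction by 1/4. *)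
  rewrite (_ : C * _ = (8 * C * w) / (4 * D * l%:R)).
    have den_gt0 : 0 < 4 * D * l%:R by rewrite !mulr_gt0.
    by rewrite (ler_pdivrMr _ _ den_gt0); lra.
  by field; rewrite !gt_eqF.
exists p; split=> // x Sx.
  have := le_trans (F_p x (Acube x Sx)) err; rewrite ler_norml => /andP[_].
  have : D <= euclid_dist [set x] B.
    apply: euclid_dist_ge => //; first by exists x.
    by move=> _ y -> By; exact: euclid_dist_le.
  move=> /(ler_wpM2l (ltW k_gt0)); rewrite mulfVK ?gt_eqF // /F; lra.
have := le_trans (F_p x (Bcube x Sx)) err; rewrite ler_norml => /andP[+ _].
by rewrite /F euclid_dist1_eq0 // mulr0; lra.
Qed.

(** * Comparison of the degree bounds and conclusion *)

(** Both sides are split into four matching factors, in [n], in [C], in [D] and a remainder that is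
    at least 1, and compared factor by factor. *)
Lemma degree_bound_ge (R : realType) n t (f : 'I_t -> mpoly n R) (c T C D : R) :
  (0 < n)%N -> (0 < family_deg f)%N -> 1 <= T -> 1 / 2 <= C -> 0 < D <= 2 ->
  D `^ T <= c / 2 ->
  8 * C * n%:R `^ (3 / 2) / D
    <= gamma f c T * C `^ (7 / 2 * n%:R * T) * n%:R `^ (3 * n%:R * T)
       * (6 / D) `^ (6 * n%:R * T).
Proof.
move=> n_gt0 deg_gt0 T_ge1 C_ge D_bd c_ge; have /andP[D_gt0 D_le2] := D_bd.
have t_gt0 : (0 < t)%N.
  by move: deg_gt0; case: t f => // f; rewrite /family_deg big_ord0.
have n_ge1 : 1 <= n%:R :> R by rewrite ler1n.
set N : R := n%:R * T; have N_ge1 : 1 <= N by rewrite /N; nra.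
have c_ge_DT : D `^ T <= c by have := powR_ge0 D T; lra.
have C_gt0 : 0 < C by lra.
rewrite /gamma -!mulrA -/N !mulrA -!(mulrA _ n%:R T) -/N.
set d := family_deg f in deg_gt0 *.
rewrite (_ : 8 * C * _ / D = n%:R `^ (3 / 2) * (2 * C) * (4 / D) * 1); last first.
  by field; rewrite gt_eqF.
rewrite [leRHS](_ : _ = n%:R ^+ 3 * (2 `^ (5 * N) * C `^ (7 / 2 * N))
    * (c ^+ (2 * n) * (6 / D) `^ (6 * N))
    * (t%:R ^+ n * d%:R ^+ n * n%:R `^ (3 * N))); last by ring.
have D6_ge1 : 1 <= 6 / D by rewrite ler_pdivlMr // mul1r; lra.
have nn_le : n%:R `^ (3 / 2) <= n%:R ^+ 3 :> R.
  by rewrite -powR_mulrn // ler_powR //; lra.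
(* As [2 * C >= 1], raising it to the power [7/2 * N >= 1] does not decrease it; the power of 2 so
   produced is absorbed by [2^(5N)]. *)
have C_le : 2 * C <= 2 `^ (5 * N) * C `^ (7 / 2 * N).
  apply: (@le_trans _ _ ((2 * C) `^ (7 / 2 * N))).
    by apply: le1r_powR; lra.
  rewrite powRM ?(ltW C_gt0) // ler_wpM2r ?powR_ge0 // ler_powR //; lra.
(* A small [c] is compensated by [c^(2n) >= D^(2N)]: against [(6/D)^(2N)] it leaves [6^(2N) >= 1],
   and the remaining [(6/D)^(4N)] is at least [6/D]. *)
have D_le : 4 / D <= c ^+ (2 * n) * (6 / D) `^ (6 * N).
  have cD : D `^ (2 * N) <= c ^+ (2 * n).
    rewrite (_ : 2 * N = T * (2 * n)%:R); last by rewrite natrM /N; ring.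
    by rewrite powRrM powR_mulrn ?powR_ge0 // lerXn2r ?nnegrE ?powR_ge0 //
      (le_trans (powR_ge0 D T)).
  apply: (@le_trans _ _ (D `^ (2 * N) * (6 / D) `^ (6 * N))); last first.
    by rewrite ler_wpM2r ?powR_ge0.
  rewrite (_ : 6 * N = 2 * N + 4 * N); last by ring.
  rewrite powRD; last by rewrite (@gt_eqF _ _ (6 / D)) ?implybT //; lra.
  rewrite mulrA -powRM ?divr_ge0 ?(ltW D_gt0) //.
  rewrite (_ : D * (6 / D) = 6); last by field; rewrite gt_eqF.
  apply: (@le_trans _ _ (1 * (6 / D))).
    by rewrite mul1r ler_pM2r ?invr_gt0 //; lra.
  rewrite ler_pM ?divr_ge0 ?(ltW D_gt0) //.
    by rewrite -[leLHS](powRr0 6) ler_powR //; lra.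
  by apply: le1r_powR; lra.
have one_le : 1 <= t%:R ^+ n * d%:R ^+ n * n%:R `^ (3 * N) :> R.
  rewrite -[leLHS]mulr1 ler_pM //.
    by rewrite -[leLHS]mulr1 ler_pM // exprn_ege1 // ler1n.
  by rewrite -[leLHS](powRr0 n%:R) ler_powR //; lra.
have D4_ge0 : 0 <= 4 / D by rewrite divr_ge0 // ltW.
have C2_ge0 : 0 <= 2 * C by lra.
have nC_ge0 : 0 <= n%:R `^ (3 / 2) * (2 * C) by rewrite mulr_ge0 ?powR_ge0.
apply: ler_pM => //; first exact: mulr_ge0.
by apply: ler_pM => //; apply: ler_pM => //; exact: powR_ge0.
Qed.

Theorem theorem3 (R : realType) (n r s : nat)
    (g : 'I_r -> mpoly n R) (h : 'I_s -> mpoly n R) (c T C : R) (l : nat)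
    (hn : (2 <= n)%N)
    (A_neq0 : semialg g !=set0) (B_neq0 : semialg h !=set0)
    (A_compact : compact (semialg g)) (B_compact : compact (semialg h))
    (AB_disjoint : semialg g `&` semialg h = set0)
    (A_cube : semialg g `<=` cube R n) (B_cube : semialg h `<=` cube R n)
    (Qg : quadratic_module g (one_minus_sqnorm R n))
    (Qh : quadratic_module h (one_minus_sqnorm R n))
    (g_norm : forall i, cube_norm (g i) <= 1 / 2)
    (h_norm : forall i, cube_norm (h i) <= 1 / 2)
    (loj_g : lojasiewicz g c T) (loj_h : lojasiewicz h c T)
    (C_jackson : jackson_constant C)
    (l_ge : Num.max (gamma g c T) (gamma h c T)
              * C `^ (7 / 2 * n%:R * T) * n%:R `^ (3 * n%:R * T)
              * (6 / euclid_dist (semialg g) (semialg h)) `^ (6 * n%:R * T)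
            <= l%:R) :
  exists p : mpoly n R, pdeg p = l /\ separating (semialg g) (semialg h) p.
Proof.
have n_gt0 : (0 < n)%N by exact: ltnW.
have closedS (A : set 'rV[R]_n) : compact A -> closed A.
  by apply: compact_closed; exact: (@norm_hausdorff R 'rV[R]_n).
(* The point [b] of B outside A is where the Lojasiewicz inequality for [g] is tested, and it shows
   that [g] is not a family of constants. *)
have [b Bb] := B_neq0.
have Ab : ~ semialg g b.
  by move=> Ab; have : (semialg g `&` semialg h) b by []; rewrite AB_disjoint.
set D := euclid_dist _ _ in l_ge.
have D_gt0 : 0 < D by apply: euclid_dist_compact_gt0 => //; exact: closedS.
have D_le2 : D <= 2.
  have [a Aa] := A_neq0; apply: (le_trans (euclid_dist_le Aa Bb)).
  rewrite (le_trans (ler_euclid_normD _ _)) // euclid_normN.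
  exact: lerD (semialg_euclid_norm_le1 Qg Aa) (semialg_euclid_norm_le1 Qh Bb).
have D_le_b : D <= euclid_dist [set b] (semialg g).
  apply: euclid_dist_ge => //; first by exists b.
  by move=> _ a -> Aa; rewrite euclid_distrC; exact: euclid_dist_le.
have T_ge1 : 1 <= T.
  apply: (lojasiewicz_exponent_ge1 loj_g A_neq0 A_cube (B_cube b Bb)).
  exact: lt_le_trans D_le_b.
have c_ge : D `^ T <= c / 2.
  by apply: (lojasiewicz_coef_ge loj_g g_norm (B_cube b Bb)); rewrite ltW.
have C_ge := jackson_constant_ge_half C_jackson.
have C_gt0 : 0 < C by lra.
have deg_gt0 := family_deg_gt0 A_neq0 Ab.
have D_bd : 0 < D <= 2 by rewrite D_gt0.
have l_ge_jackson : 8 * C * n%:R `^ (3 / 2) / D <= l%:R.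
  apply: le_trans l_ge.
  apply: (le_trans (degree_bound_ge n_gt0 deg_gt0 T_ge1 C_ge D_bd c_ge)).
  by rewrite !ler_wpM2r ?powR_ge0 // le_max lexx.
have l_gt0 : (0 < l)%N.
  rewrite -(ltr0n R); apply: lt_le_trans l_ge_jackson.
  by rewrite divr_gt0 // !mulr_gt0 // powR_gt0 // ltr0n.
have [p [deg_p p_A p_B]] := jackson_separation C_jackson (ltW C_gt0) n_gt0 l_gt0
  A_cube B_cube A_neq0 B_neq0 D_gt0 l_ge_jackson.
(* The perturbation by at most 1/4 uses up exactly the slack in 5/4 and -1/4, leaving the thresholds
   1 and 0. *)
have [q deg_q q_p] := exists_pdeg_close n_gt0 deg_p (divr_gt0 ltr01 (ltr0n R 4)).
exists q; split=> //; split=> x Sx.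
  by have := p_A x Sx; have /ler_normlP[] := q_p x (A_cube x Sx); lra.
by have := p_B x Sx; have /ler_normlP[] := q_p x (B_cube x Sx); lra.
Qed.
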